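(* Let $P_x$ be the training data distribution, satisfying $\mathbb E_{x\sim P_x}[\|x\|^2]<+\infty$. Then for any fixed data distribution $\tilde P_x$ on $X$ with $\mathbb E_{x\sim\tilde P_x}[\|x\|^2]<+\infty$ we have $$\lim_{\delta\to0}\ \mathbb E_{x\sim\tilde P_x}\ \sup_{\varepsilon\in S_\delta}\|R^{adv_\infty}_\delta(Ax+\varepsilon)-A^\dagger Ax\|^2=0,$$ as well as $$\lim_{\delta\to0}\ \sup_{P_\varepsilon\in\mathcal S_\delta}\ \mathbb E_{x\sim\tilde P_x,\,\varepsilon\sim P_\varepsilon}\|R^{adv_\infty}_\delta(Ax+\varepsilon)-A^\dagger Ax\|^2=0 .$$
   Context: $X,Y$ are real Hilbert spaces and $A:X\to Y$ is a compact linear operator with singular value expansion $Ax=\sum_{n\in\mathbb N}\sigma_n\langle x,u_n\rangle v_n$, where $\sigma_n>0$, $(u_n)$ is an orthonormal basis of $\mathcal N(A)^\perp$ and $(v_n)$ an orthonormal basis of $\overline{\mathcal R(A)}$. $A^\dagger$ is the pseudo-inverse, so $A^\dagger A$ is the orthogonal projection onto $\mathcal N(A)^\perp$. Data distributions are probability distributions on $X$. For a real sequence $g$, $R[g](y)=\sum_n g_n\langle y,v_n\rangle u_n$; norms of divergent series are $+\infty$. For $\delta>0$, $S_\delta=\{\varepsilon\in Y:|\langle\varepsilon,v_n\rangle|\le\delta\ \forall n\}$, and $\mathcal S_\delta=\{P_\varepsilon:\mathbb E_{\varepsilon\sim P_\varepsilon}\langle\varepsilon,v_n\rangle^2\le\delta^2\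 \forall n\}$ is the set of noise distributions with white noise level at most $\delta$. Noise $\varepsilon\sim P_\varepsilon$ has zero mean, is independent of $x$, and enters only through its coefficients $\langle\varepsilon,v_n\rangle$. $R^{adv_\infty}_\delta=R[g^{adv_\infty}]$, where $g^{adv_\infty}=g^{adv_\infty}(\delta)\in\ell^2$ is the following minimizer of $g\mapsto\mathbb E_{x\sim P_x}\sup_{\varepsilon\in S_\delta}\|R[g](Ax+\varepsilon)-x\|^2$. Writing $E_n=\mathbb E_{x\sim P_x}|\langle x,u_n\rangle|$ and $Q_n=\mathbb E_{x\sim P_x}\langle x,u_n\rangle^2$: $g_n^{adv_\infty}=0$ if $E_n=0$ or $Q_n/E_n\le\delta/\sigma_n$; otherwise $$g_n^{adv_\infty}=\begin{cases}\Big(\sigma_n-\delta\,\frac{\sigma_nE_n-\delta}{\sigma_nQ_n-\delta E_n}\Big)^{-1}&\text{if }E_n<\frac{\delta}{\sigma_n}<\frac{Q_n}{E_n},\\[4pt]\frac1{\sigma_n}&\text{if }\frac{\delta}{\sigma_n}\le E_n.\end{cases}$$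
   Formalization: Added hypothesis: whenever E_{x~P_x}|<x,u_n>| = 0, also E_{x~P̃_x}|<x,u_n>| = 0; without it the claim fails (P_x = Dirac at 0, P̃_x = Dirac at u_0: R = 0 and both risks are at least 1). *)

(* Defs.v *)
From HB Require Import structures.
From mathcomp Require Import all_boot all_order all_algebra.
From mathcomp Require Import all_classical all_reals all_analysis.

Set Implicit Arguments.
Unset Strict Implicit.
Unset Printing Implicit Defensive.

Import Order.TTheory GRing.Theory Num.Theory.
Import numFieldNormedType.Exports.

Local Open Scope classical_set_scope.
Local Open Scope ring_scope.

HB.mixin Record isHilbert (R : realType) T of CompleteNormedModule R T := {
  inner : {dot T for idfun} ;
  inner_normE : forall x : T, inner x x = `|x| ^+ 2
}.

#[short(type="hilbertType")]
HB.structure Definition Hilbert (R : realType) :=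
  {T of CompleteNormedModule R T & isHilbert R T}.

Notation "'[ x , y ]" := (inner x%R y%R) : ring_scope.

Definition orthogonal_complement (R : realType) (X : hilbertType R)
    (S : set X) : set X :=
  [set x | forall y, S y -> '[x, y] = 0].

Definition is_orthonormal_basis (R : realType) (X : hilbertType R)
    (V : set X) (e : nat -> X) : Prop :=
  [/\ forall n, V (e n),
      forall i j, '[e i, e j] = (i == j)%:R
    & forall x, V x -> series (fun n => '[x, e n] *: e n) @ \oo --> x].

Definition compact_operator (R : realType) (X Y : hilbertType R)
    (A : X -> Y) : Prop :=
  forall B : set X, bounded_set B -> precompact (A @` B).

Record singular_value_expansion (R : realType) (X Y : hilbertType R)
    (A : X -> Y) (sigma : nat -> R) (u : nat -> X) (v : nat -> Y) : Prop := {
  sve_gt0 : forall n, 0 < sigma n ;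
  sve_u : is_orthonormal_basis (orthogonal_complement [set x | A x = 0]) u ;
  sve_v : is_orthonormal_basis (closure (range A)) v ;
  sve_cvg : forall x,
    series (fun n => (sigma n * '[x, u n]) *: v n) @ \oo --> A x
}.

Definition least_squares (R : realType) (X Y : hilbertType R)
    (A : X -> Y) (y : Y) : set X :=
  [set x | forall z, `|A x - y| <= `|A z - y|].

(* The best-approximate solution of A x = y, i.e. the least-squares solution of
   minimal norm; the junk value 0 is taken outside the domain of the
   pseudo-inverse, which contains the range of A. *)
Definition pseudo_inverse (R : realType) (X Y : hilbertType R)
    (A : X -> Y) (y : Y) : X :=
  xget 0 [set x | least_squares A y x /\
                  forall z, least_squares A y z -> `|x| <= `|z|].

Notation borel_space T := (g_sigma_algebraType (@open T)).

(* Sequences of noise coefficients (<eps, v_n>)_n, with the product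
   sigma-algebra.  White noise on an infinite-dimensional space is not a random
   element of Y, so noise is modelled by the law of its coefficients. *)
Notation noise_space R :=
  (g_sigma_algebraType [set C : set (nat -> R) |
     exists n (B : set R), measurable B /\ C = (fun c => c n) @^-1` B]).

Definition noise_coef (R : realType) (n : nat) (c : noise_space R) : R :=
  (c : nat -> R) n.

(* Partial sums of R[g], as a function of the coefficients c n = <y, v_n>. *)
Definition spectral_series (R : realType) (X : hilbertType R)
    (u : nat -> X) (g c : nat -> R) : nat -> X :=
  series (fun n => (g n * c n) *: u n).

(* Squared distance from the sum of a series, given by its partial sums s, to
   z; it is +oo if the series diverges. *)
Definition sq_error (R : realType) (X : hilbertType R)
    (s : nat -> X) (z : X) : \bar R :=
  if `[< cvgn s >] then (`|limn s - z| ^+ 2)%:E else +oo%E.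

Definition abs_moment (R : realType) (X : hilbertType R)
    (P : probability (borel_space X) R) (u : nat -> X) (n : nat) : R :=
  fine 'E_P[fun x => (`|'[x, u n]|)%R]%E.

Definition sq_moment (R : realType) (X : hilbertType R)
    (P : probability (borel_space X) R) (u : nat -> X) (n : nat) : R :=
  fine 'E_P[fun x => ('[x, u n] ^+ 2)%R]%E.

(* Coefficientwise minimizer of the expectation under P of the supremum over
   adv_noise v delta of |R[g](A x + eps) - x|^2.  Where this minimizer is not
   unique (delta / s = E = Q / E), the value 0 is selected. *)
Definition g_adv (R : realType) (X : hilbertType R)
    (P : probability (borel_space X) R) (sigma : nat -> R) (u : nat -> X)
    (delta : R) (n : nat) : R :=
  let s := sigma n in
  let E := abs_moment P u n in
  let Q := sq_moment P u n in
  if (E == 0) || (Q / E <= delta / s) then 0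
  else if delta / s <= E then s^-1
  else (s - delta * ((s * E - delta) / (s * Q - delta * E)))^-1.

Definition adv_noise (R : realType) (Y : hilbertType R) (v : nat -> Y)
    (delta : R) : set Y :=
  [set eps | forall n, `|'[eps, v n]| <= delta].

Definition white_noise (R : realType) (delta : R) :
    set (probability (noise_space R) R) :=
  [set P | (forall n, 'E_P[@noise_coef R n]%E = 0%E) /\
           (forall n, ('E_P[fun c => (noise_coef n c ^+ 2)%R]
                         <= (delta ^+ 2)%:E)%E)].
Arguments white_noise R delta : clear implicits.

Definition adv_risk (R : realType) (X Y : hilbertType R) (A : X -> Y)
    (u : nat -> X) (v : nat -> Y) (P : probability (borel_space X) R)
    (g : nat -> R) (delta : R) : \bar R :=
  (\int[P]_x ereal_sup
     [set sq_error (spectral_series u g (fun n => '[A x + eps, v n]))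
                   (pseudo_inverse A (A x)) | eps in adv_noise v delta])%E.

(* Independence of x and the noise is the use of the product measure. *)
Definition white_noise_risk (R : realType) (X Y : hilbertType R) (A : X -> Y)
    (u : nat -> X) (v : nat -> Y) (P : probability (borel_space X) R)
    (g : nat -> R) (delta : R) : \bar R :=
  ereal_sup
    [set (\int[P \x Pe]_w
       sq_error (spectral_series u g
                   (fun n => ('[A w.1, v n] + noise_coef n w.2)%R))
                (pseudo_inverse A (A w.1)))%E | Pe in white_noise R delta].

(* Main.v *)
Require Import Defs.
From mathcomp Require Import all_boot all_order all_algebra.
From mathcomp Require Import all_classical all_reals all_analysis.
From mathcomp Require Import measurable_realfun ring lra.
Import Order.TTheory GRing.Theory Num.Theory.
Import numFieldNormedType.Exports.
Local Open Scope classical_set_scope.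
Local Open Scope ring_scope.

(* Since A^+ A x = sum_n <x, u_n> u_n, the squared error at x under noise
   coefficients e_n is sum_n ((g_n sigma_n - 1) <x, u_n> + g_n e_n)^2, so both
   risks are at most
     2 sum_n ((1 - g_n sigma_n)^2 Qt_n + delta^2 g_n^2),
   where Qt_n is the second moment of <x, u_n> under the test distribution and
   Q_n the one under the training distribution.  As g_n(delta) minimizes the
   worst-case training risk of the n-th coefficient, whose value at g = 0 is
   Q_n, one has delta^2 g_n^2 <= Q_n, and 0 <= g_n sigma_n <= 1; so the n-th
   term is dominated by Qt_n + Q_n, which is summable.  If E_n > 0 then
   g_n = 1 / sigma_n for small delta, and if E_n = 0 then g_n = 0 = Qt_n; in
   both cases the n-th term tends to 0, and dominated convergence for series
   concludes. *)

(** * Orthonormal expansions in a Hilbert space *)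

Lemma innerC {R : realType} {X : hilbertType R} (x y : X) : '[x, y] = '[y, x].
Proof. by rewrite hermC expr0 mul1r. Qed.

Lemma normB_sqr {R : realType} {X : hilbertType R} (x y : X) :
  `|x - y| ^+ 2 = `|x| ^+ 2 - '[x, y] *+ 2 + `|y| ^+ 2.
Proof.
rewrite -!inner_normE linearBl !linearBr /= (innerC y x) mulr2n.
by rewrite opprB !opprD !addrA (addrAC _ '[y, y]).
Qed.

Definition orthonormal_seq {R : realType} {X : hilbertType R} (e : nat -> X) :=
  forall i j, '[e i, e j] = (i == j)%:R.

(** Cauchy-Schwarz against a unit vector: the residual of x along e_n has nonnegative squared
    norm. *)
Lemma inner_le_norm {R : realType} {X : hilbertType R} (e : nat -> X) n (x : X) :
  orthonormal_seq e -> `|'[x, e n]| <= `|x|.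
Proof.
move=> eO; rewrite -ler_sqr ?nnegrE// real_normK ?num_real// -subr_ge0.
have := sqr_ge0 `|x - '[x, e n] *: e n|.
rewrite normB_sqr -!inner_normE linearZl_LR !linearZr_LR /= eO eqxx mulr1.
by rewrite expr2 mulr2n opprD addrA subrK inner_normE.
Qed.

Lemma inner_continuous {R : realType} {X : hilbertType R} (e : nat -> X) n :
  orthonormal_seq e -> continuous (fun x : X => '[x, e n]).
Proof.
move=> eO x; apply/cvgrPdist_lt => eps eps0; near=> y.
rewrite -linearBl; apply: le_lt_trans (inner_le_norm e n _ eO) _.
by near: y; apply: cvgr_dist_lt.
Unshelve. all: by end_near. Qed.

Lemma inner_sum {R : realType} {X : hilbertType R} (e : nat -> X) (a : nat -> R)
    m n j : orthonormal_seq e ->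
  '[\sum_(m <= k < n) a k *: e k, e j] = if (m <= j < n)%N then a j else 0.
Proof.
move=> eO; rewrite linear_sumlz -(big_nat1_eq +%R) [RHS]big_mkcond.
by apply: eq_bigr => k _; rewrite linearZl_LR /= eO; case: eqP => _;
  rewrite ?mulr1 ?mulr0.
Qed.

Lemma norm_sum_sqr {R : realType} {X : hilbertType R} (e : nat -> X)
    (a : nat -> R) m n : orthonormal_seq e ->
  `|\sum_(m <= k < n) a k *: e k| ^+ 2 = \sum_(m <= k < n) a k ^+ 2.
Proof.
move=> eO; rewrite -inner_normE linear_sumr big_nat [RHS]big_nat.
by apply: eq_bigr => k mkn; rewrite linearZr_LR /= inner_sum// mkn expr2.
Qed.

Lemma norm_sub_sum_sqr {R : realType} {X : hilbertType R} (e : nat -> X)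
    (x : X) m n : orthonormal_seq e ->
  `|x - \sum_(m <= k < n) '[x, e k] *: e k| ^+ 2 =
  `|x| ^+ 2 - \sum_(m <= k < n) '[x, e k] ^+ 2.
Proof.
move=> eO; rewrite normB_sqr norm_sum_sqr// linear_sumr /=.
under eq_bigr do rewrite linearZr_LR /= -expr2.
by rewrite mulr2n opprD addrA subrK.
Qed.

Lemma bessel {R : realType} {X : hilbertType R} (e : nat -> X) (x : X) m n :
  orthonormal_seq e -> \sum_(m <= k < n) '[x, e k] ^+ 2 <= `|x| ^+ 2.
Proof. by move=> eO; rewrite -subr_ge0 -norm_sub_sum_sqr// sqr_ge0. Qed.

(** By Pythagoras a block of the scalar series is the squared norm of the same block of the vector
    series, so the Cauchy property carries over and completeness concludes. *)
Lemma riesz_fischer {R : realType} {X : hilbertType R} (e : nat -> X)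
    (a : nat -> R) : orthonormal_seq e ->
  cvgn (series (fun n => a n ^+ 2)) -> cvgn (series (fun n => a n *: e n)).
Proof.
move=> eO /cvg_cauchy /cauchy_seriesP ac.
apply/cauchy_cvgP/cauchy_seriesP => eps eps0.
(* The tolerance is [eps ^+ 2] because scalar blocks are squared norms. *)
have := ac _ (exprn_gt0 2 eps0); apply: filterS => -[m n] /=.
rewrite -(norm_sum_sqr e)// ger0_norm ?sqr_ge0// ltr_sqr ?nnegrE//.
exact: ltW.
Qed.

(** The inner product with e_n is continuous, and on the partial sums it is constant once the n-th
    term is included. *)
Lemma inner_limit {R : realType} {X : hilbertType R} (e : nat -> X)
    (a : nat -> R) (x : X) n : orthonormal_seq e ->
  series (fun n => a n *: e n) @ \oo --> x -> '[x, e n] = a n.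
Proof.
move=> eO ax.
have /(cvg_lim (@Rhausdorff R)) <- : '[series (fun n => a n *: e n) k, e n]
    @[k --> \oo] --> '[x, e n].
  exact: (cvg_comp _ _ ax (inner_continuous e n eO x)).
apply: lim_near_cst; first exact: Rhausdorff.
by near=> k; rewrite inner_sum// leq0n /=; case: ifPn => // /negP[]; near: k;
  exact: nbhs_infty_gt.
Unshelve. all: by end_near. Qed.

Lemma norm_limit_sqr {R : realType} {X : hilbertType R} (e : nat -> X)
    (a : nat -> R) (x : X) : orthonormal_seq e ->
  series (fun n => a n *: e n) @ \oo --> x ->
  series (fun n => a n ^+ 2) @ \oo --> `|x| ^+ 2.
Proof.
move=> eO ax.
have -> : series (fun n => a n ^+ 2) =
    (fun k => `|series (fun n => a n *: e n) k| ^+ 2).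
  by apply/funext => k; rewrite norm_sum_sqr.
by rewrite expr2; apply: cvgM; apply: cvg_norm.
Qed.

Lemma cvg_inner_series {R : realType} {X : hilbertType R} (e : nat -> X) (x : X) :
  orthonormal_seq e -> cvgn (series (fun n => '[x, e n] *: e n)).
Proof.
move=> eO; apply: riesz_fischer => //.
apply: nondecreasing_is_cvgn; last first.
  by exists (`|x| ^+ 2) => _ [n _ <-]; exact: bessel.
by apply: nondecreasing_series => n _ _; exact: sqr_ge0.
Qed.

(** Equal coefficients still allow z a part orthogonal to every e_n; the norm bound excludes it,
    since |z - x|^2 is the limit of |z|^2 - sum_{k<n} <x, e_k>^2, which is at most a sequence
    tending to 0. *)
Lemma eq_of_inner_eq {R : realType} {X : hilbertType R} (e : nat -> X)
    (x z : X) : orthonormal_seq e ->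
  series (fun n => '[x, e n] *: e n) @ \oo --> x ->
  (forall n, '[z, e n] = '[x, e n]) -> `|z| <= `|x| -> z = x.
Proof.
move=> eO ex zx lezx; apply/eqP; rewrite -subr_eq0 -normr_eq0 -sqrf_eq0.
rewrite eq_le sqr_ge0 andbT.
have cz : `|z - series (fun n => '[x, e n] *: e n) k| ^+ 2 @[k --> \oo]
    --> `|z - x| ^+ 2.
  by rewrite expr2; apply: cvgM; apply: cvg_norm; apply: cvgB => //; apply: cvg_cst.
have cx : `|x| ^+ 2 - series (fun n => '[x, e n] ^+ 2) k @[k --> \oo] --> 0.
  rewrite -[X in _ --> X](subrr (`|x| ^+ 2)); apply: cvgB; first exact: cvg_cst.
  exact: norm_limit_sqr ex.
rewrite -(cvg_lim (@Rhausdorff R) cz) -(cvg_lim (@Rhausdorff R) cx).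
apply: ler_lim; [exact: cvgP cz|exact: cvgP cx|apply: nearW => k].
rewrite (_ : (fun n => '[x, e n] *: e n) = (fun n => '[z, e n] *: e n)).
  rewrite /series /= norm_sub_sum_sqr// lerB ?ler_sqr ?nnegrE//.
  by apply: ler_sum => j _; rewrite zx.
by apply/funext => n; rewrite zx.
Qed.

(** * Pseudo-inverse and squared error in coefficients *)

(** Least-squares solutions for A x are exactly the z with A z = A x. All share the coefficients of
    x, so by Bessel the sum p of the series has least norm, and [eq_of_inner_eq] makes it the only
    minimizer. *)
Lemma pseudo_inverse_series {R : realType} {X Y : hilbertType R}
    (A : {linear X -> Y}) (sigma : nat -> R) (u : nat -> X) (v : nat -> Y)
    (x : X) : singular_value_expansion A sigma u v ->
  series (fun n => '[x, u n] *: u n) @ \oo --> pseudo_inverse A (A x).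
Proof.
move=> [s0 [_ uO _] [_ vO _] Av].
have /cvg_ex[p xp] := cvg_inner_series u x uO.
have pu n : '[p, u n] = '[x, u n] by exact: inner_limit xp.
have Ainner z n : '[A z, v n] = sigma n * '[z, u n] by exact: inner_limit (Av z).
have Ap : A p = A x.
  have := Av p; rewrite (_ : (fun n => (sigma n * '[p, u n]) *: v n) =
    (fun n => (sigma n * '[x, u n]) *: v n)); last first.
    by apply/funext => n; rewrite pu.
  by move=> /(cvg_lim (@norm_hausdorff _ Y)) <-; apply/cvg_lim.
have lsE z : least_squares A (A x) z <-> A z = A x.
  split=> [/(_ x)|Az w]; last by rewrite Az subrr normr0.
  by rewrite subrr normr0 normr_le0 subr_eq0 => /eqP.
have pmin z : A z = A x -> `|p| <= `|z|.
  move=> Az; rewrite -ler_sqr ?nnegrE//.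
  rewrite -(cvg_lim (@Rhausdorff R) (norm_limit_sqr _ _ _ uO xp)).
  apply: limr_le; first exact: cvgP (norm_limit_sqr _ _ _ uO xp).
  apply: nearW => k; apply: le_trans (bessel u z 0 k uO).
  apply: ler_sum => n _; rewrite (_ : '[x, u n] = '[z, u n])//.
  by apply: (mulfI (lt0r_neq0 (s0 n))); rewrite -!Ainner Az.
suff -> : pseudo_inverse A (A x) = p by [].
(* The default branch of [xget] is impossible, since p itself is a candidate. *)
rewrite /pseudo_inverse; case: xgetP => [z _ [/lsE Az zmin]|/(_ p)[]].
- apply: (eq_of_inner_eq u) => //.
  + by under [fun n => _]eq_fun do rewrite pu.
  + move=> n; rewrite pu; apply: (mulfI (lt0r_neq0 (s0 n))).
    by rewrite -!Ainner Az.
  + by apply: zmin; apply/lsE.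
- by split=> [|z /lsE]; [apply/lsE|exact: pmin].
Qed.

(** If the right-hand side is finite, Riesz-Fischer makes the error series converge, hence the
    spectral series too, and Parseval gives equality. *)
Lemma sq_error_le {R : realType} {X : hilbertType R} (u : nat -> X)
    (g c d : nat -> R) (p : X) : orthonormal_seq u ->
  series (fun n => c n *: u n) @ \oo --> p ->
  (sq_error (spectral_series u g d) p <=
   \sum_(n <oo) ((g n * d n - c n) ^+ 2)%:E)%E.
Proof.
move=> uO cp; have [->|fin] := eqVneq (\sum_(n <oo) ((g n * d n - c n) ^+ 2)%:E)%E +oo%E.
  exact: leey.
have sqc : cvgn (series (fun n => (g n * d n - c n) ^+ 2)).
  apply: nnseries_is_cvg => [n|]; first exact: sqr_ge0.
  by rewrite ltey.
have /cvg_ex[q dq] := riesz_fischer u _ uO sqc.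
have gd : spectral_series u g d @ \oo --> q + p.
  rewrite (_ : spectral_series u g d =
    series (fun n => (g n * d n - c n) *: u n) \+ series (fun n => c n *: u n)).
    exact: cvgD.
  apply/funext => k; rewrite /spectral_series /series /= -big_split /=.
  by apply: eq_bigr => n _; rewrite -scalerDl subrK.
rewrite /sq_error; case: asboolP => [_|[]]; last exact: cvgP gd.
rewrite (cvg_lim (@norm_hausdorff _ X) gd) addrK.
have := norm_limit_sqr u _ _ uO dq => /(cvg_lim (@Rhausdorff R)) <-.
rewrite -EFin_lim// le_eqVlt; apply/orP; left; apply/eqP/congr_lim/funext => k.
by rewrite sumEFin.
Qed.

(** * Integrals, measurability and marginals *)

(* The integral of a nonnegative function is a supremum over simple functions,
   so monotonicity needs no measurability; the integrands of the two risks are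
   not known to be measurable. *)
Lemma le_integral_ge0 d (T : measurableType d) (R : realType)
    (mu : measure T R) (f1 f2 : T -> \bar R) :
  (forall x, 0 <= f1 x)%E -> (forall x, f1 x <= f2 x)%E ->
  (\int[mu]_x f1 x <= \int[mu]_x f2 x)%E.
Proof.
move=> f10 f12.
rewrite !ge0_integralTE//; last by move=> x; exact: le_trans (f12 x).
apply: le_ereal_sup => _ [h /= hf1 <-]; exists h => //= x.
exact: le_trans (f12 x).
Qed.

Lemma measurable_continuous_borel {R : realType} {X : hilbertType R}
    (f : X -> R) : continuous f ->
  measurable_fun setT (f : borel_space X -> R).
Proof.
move=> /continuousP cf; apply: (measurability _ (RGenOpens.measurableE R)).
move=> _ [_ [a [b ->] <-]]; rewrite setTI.
by apply: sub_sigma_algebra; apply: cf; exact: interval_open.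
Qed.

Lemma measurable_inner {R : realType} {X : hilbertType R} (u : nat -> X) n :
  orthonormal_seq u ->
  measurable_fun setT (fun x : borel_space X => '[x : X, u n]).
Proof.
move=> uO; apply: (measurable_continuous_borel (fun x : X => '[x, u n])).
exact: inner_continuous.
Qed.

Lemma integral_fst {d d'} {T : measurableType d} {T' : measurableType d'}
    {R : realType} (P : probability T R) (P' : probability T' R)
    {f : T -> \bar R} :
  measurable_fun setT f -> (forall x, 0 <= f x)%E ->
  (\int[P \x P']_w f w.1 = \int[P]_x f x)%E.
Proof.
move=> mf f0; rewrite fubini_tonelli1//=; last first.
  exact: measurableT_comp.
apply: eq_integral => x _; rewrite /fubini_F /= integral_cst//=.
by rewrite [X in (_ * X)%E]probability_setT mule1.
Qed.

Lemma integral_snd {d d'} {T : measurableType d} {T' : measurableType d'}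
    {R : realType} (P : probability T R) (P' : probability T' R)
    {f : T' -> \bar R} :
  measurable_fun setT f -> (forall x, 0 <= f x)%E ->
  (\int[P \x P']_w f w.2 = \int[P']_x f x)%E.
Proof.
move=> mf f0; rewrite fubini_tonelli1//=; last first.
  exact: measurableT_comp.
rewrite /fubini_F /= integral_cst//=.
by rewrite [X in (_ * X)%E]probability_setT mule1.
Qed.

(** * Dominated convergence for series *)

(** Domination makes a tail small uniformly in t; the remaining finite head tends to 0 termwise. *)
Lemma nneseries_dominated_cvg0 (R : realType) (T : Type) (F : set_system T)
    (FF : Filter F) (a : T -> nat -> R) (b : nat -> R) :
  (forall n, 0 <= b n) -> (\sum_(n <oo) (b n)%:E < +oo)%E ->
  (\forall t \near F, forall n, 0 <= a t n <= b n) ->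
  (forall n, a t n @[t --> F] --> 0) ->
  (\sum_(n <oo) (a t n)%:E)%E @[t --> F] --> 0%E.
Proof.
move=> b0 boo ab a0.
have small eps : 0 < eps ->
    \forall t \near F, (0 <= \sum_(n <oo) (a t n)%:E <= eps%:E)%E.
  move=> eps0; have eps2 : 0 < eps / 2 by rewrite divr_gt0.
  have [N bN] : exists N, (\sum_(N <= n <oo) (b n)%:E <= (eps / 2)%:E)%E.
    have /fine_cvgP[fin /cvgrPdist_le/(_ _ eps2) bN] :
        (\sum_(N <= n <oo) (b n)%:E)%E @[N --> \oo] --> 0%E.
      by apply: nneseries_tail_cvg => // n _; rewrite lee_fin.
    have [N [fN bN']] := filter_ex (filterI fin bN); exists N.
    rewrite -(fineK fN) lee_fin; apply: le_trans bN'.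
    by rewrite sub0r normrN ler_norm.
  have : \sum_(0 <= n < N) a t n @[t --> F] --> \sum_(0 <= n < N) (0 : R).
    by apply: cvg_big => [|n _]; [exact: add_continuous|exact: a0].
  rewrite big1// => /cvgrPdist_le/(_ _ eps2) aN.
  near=> t; have abt : forall n, 0 <= a t n <= b n by near: t.
  rewrite nneseries_ge0/=; last first.
    by move=> n *; rewrite lee_fin; case/andP: (abt n).
  rewrite (nneseries_split 0 N); last first.
    by move=> k _; rewrite lee_fin; case/andP: (abt k).
  rewrite add0n sumEFin [eps]splitr EFinD; apply: leeD.
    rewrite lee_fin; apply: le_trans (ler_norm _) _.
    by rewrite -normrN -sub0r; near: t.
  apply: le_trans bN; apply: lee_nneseries => k *;
    by rewrite lee_fin; case/andP: (abt k).
(* Convergence in the extended reals includes eventual finiteness, obtained from [small] with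
   tolerance 1. *)
apply/fine_cvgP; split.
  have := small _ (@ltr01 R); apply: filterS => t /andP[S0 S1].
  by rewrite ge0_fin_numE// (le_lt_trans S1)// ltry.
apply/cvgrPdist_le => eps /small; apply: filterS => t /andP[S0 S1].
have Sf : (\sum_(n <oo) (a t n)%:E)%E \is a fin_num.
  by rewrite ge0_fin_numE// (le_lt_trans S1)// ltry.
by rewrite sub0r normrN ger0_norm ?fine_ge0// -lee_fin fineK.
Unshelve. all: by end_near. Qed.

(** * The adversarial filter [g_adv] *)

(** With t = delta / sigma_n and h = g sigma_n, the claims are 0 <= h <= 1 and t^2 h^2 <= Q. In the
    branch h = 1 they follow from t <= E and t E < Q; the remaining nonzero branch uses optimality
    of h. *)
Lemma g_adv_bounds {R : realType} {X : hilbertType R}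
    (P : probability (borel_space X) R) (sigma : nat -> R) (u : nat -> X)
    (delta : R) (n : nat) :
  0 < delta -> 0 < sigma n -> 0 <= abs_moment P u n -> 0 <= sq_moment P u n ->
  let g := g_adv P sigma u delta n in
  [/\ 0 <= g, g * sigma n <= 1 & delta ^+ 2 * g ^+ 2 <= sq_moment P u n].
Proof.
rewrite /g_adv; set s := sigma n; set E := abs_moment P u n.
set Q := sq_moment P u n => d0 s0 E0 Q0 /=.
case: ifPn => [_|]; first by split; rewrite ?mul0r ?expr0n ?mulr0.
rewrite negb_or -ltNge => /andP[En0 tQ].
have Ep : 0 < E by rewrite lt_neqAle eq_sym En0.
have ds : delta = delta / s * s by rewrite divfK// gt_eqF.
set t := delta / s in tQ ds *; have t0 : 0 < t by rewrite divr_gt0.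
clearbody t; subst delta; have tEQ : t * E < Q by rewrite -ltr_pdivlMr.
case: (leP t E) => [tE|Et].
  split; [by rewrite invr_ge0 ltW|by rewrite mulVf// gt_eqF|].
  rewrite -exprMn mulfK ?gt_eqF//; apply: le_trans (ltW tEQ).
  by rewrite expr2 ler_pM2l.
(* [D] is Q - 2 t E + t^2, the leading coefficient in h of the worst-case risk; this grouping shows
   that it is positive. *)
set D := Q - t * E + t * (t - E).
have D0 : 0 < D by rewrite /D; nra.
set h := (Q - t * E) / D.
have -> : (s - t * s * ((s * E - t * s) / (s * Q - t * s * E)))^-1 = h / s.
  rewrite /h /D; field; rewrite !gt_eqF//.
  - rewrite (_ : _ - _ = s * s * D); last by rewrite /D; ring.
    by rewrite !mulr_gt0.
  - rewrite (_ : _ - _ = s * (Q - t * E)); last by ring.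
    by rewrite mulr_gt0// subr_gt0.
have h0 : 0 <= h by apply: divr_ge0; rewrite ?subr_ge0 ltW.
(* Stationarity: the derivative of the worst-case risk vanishes at h. *)
have hD : h * D = Q - t * E by rewrite divfK// gt_eqF.
have h1 : h <= 1.
  by rewrite ler_pdivrMr// mul1r lerDl mulr_ge0 ?subr_ge0// ltW.
split; [by rewrite divr_ge0// ltW|by rewrite divfK ?gt_eqF|].
rewrite -exprMn (_ : t * s * (h / s) = t * h); last by field; rewrite gt_eqF.
clearbody h.
(* The worst-case risk (1 - h)^2 Q + 2 h (1 - h) t E + h^2 t^2 of the
   minimizer h is at most its value Q at h = 0. *)
suff : (t * h) ^+ 2 + (1 - h) ^+ 2 * Q + 2 * (h * (1 - h) * (t * E)) =
    Q - h * (Q - t * E).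
  have : 0 <= (1 - h) ^+ 2 * Q by rewrite mulr_ge0// sqr_ge0.
  have : 0 <= h * (1 - h) * (t * E).
    by rewrite !mulr_ge0// ?subr_ge0// ltW.
  have : 0 <= h * (Q - t * E) by rewrite mulr_ge0// subr_ge0 ltW.
  lra.
transitivity (Q - 2 * (h * (Q - t * E)) + h * (h * D)); first by rewrite /D; ring.
by rewrite hD; ring.
Qed.

(** It suffices that delta / sigma_n be below E_n and Q_n / E_n; these thresholds depend on n, so
    the convergence is termwise. *)
Lemma g_adv_near0 {R : realType} {X : hilbertType R}
    (P : probability (borel_space X) R) (sigma : nat -> R) (u : nat -> X)
    (n : nat) : 0 < sigma n -> 0 < abs_moment P u n -> 0 < sq_moment P u n ->
  \forall delta \near 0^'+, g_adv P sigma u delta n = (sigma n)^-1.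
Proof.
move=> s0 E0 Q0; near=> delta.
rewrite /g_adv gt_eqF//= leNgt ltr_pdivrMr// ifF; last first.
  apply/negbTE; rewrite negbK; near: delta; apply: nbhs_right_lt.
  by rewrite mulr_gt0// divr_gt0.
rewrite ler_pdivrMr// ifT//; near: delta; apply: nbhs_right_le.
by rewrite mulr_gt0.
Unshelve. all: by end_near. Qed.

(** * Moments of the coefficients *)

Lemma expectationE d (T : measurableType d) (R : realType)
    (P : probability T R) (f : T -> R) : ('E_P[f] = \int[P]_x (f x)%:E)%E.
Proof. by rewrite unlock. Qed.

(** The integral is finite by [inner_le_norm], so [fine] in [sq_moment] loses nothing. *)
Lemma integral_inner_sqr {R : realType} {X : hilbertType R}
    (P : probability (borel_space X) R) (u : nat -> X) n : orthonormal_seq u ->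
  ('E_P[fun x : X => (`|x| ^+ 2)%R] < +oo)%E ->
  (\int[P]_x ('[x : X, u n] ^+ 2)%:E = (sq_moment P u n)%:E)%E.
Proof.
move=> uO P2; rewrite /sq_moment expectationE fineK// ge0_fin_numE; last first.
  by apply: integral_ge0 => x _; rewrite lee_fin sqr_ge0.
apply: le_lt_trans P2; rewrite expectationE; apply: le_integral_ge0 => x.
  by rewrite lee_fin sqr_ge0.
rewrite lee_fin -real_normK ?num_real// ler_sqr ?nnegrE//.
exact: inner_le_norm.
Qed.

Lemma measurable_inner_sqr {R : realType} {X : hilbertType R} (u : nat -> X) n :
  orthonormal_seq u ->
  measurable_fun setT (fun x : borel_space X => ('[x : X, u n] ^+ 2)%:E).
Proof.
move=> uO; apply/measurable_EFinP; apply: measurable_funX.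
exact: measurable_inner.
Qed.

Lemma sq_moment_ge0 {R : realType} {X : hilbertType R}
    (P : probability (borel_space X) R) (u : nat -> X) n :
  0 <= sq_moment P u n.
Proof.
rewrite /sq_moment fine_ge0// expectationE integral_ge0// => x _.
by rewrite lee_fin sqr_ge0.
Qed.

Lemma abs_moment_ge0 {R : realType} {X : hilbertType R}
    (P : probability (borel_space X) R) (u : nat -> X) n :
  0 <= abs_moment P u n.
Proof.
by rewrite /abs_moment fine_ge0// expectationE integral_ge0.
Qed.

(** Tonelli exchanges sum and integral, and Bessel bounds the integrand by |x|^2. *)
Lemma nneseries_sq_moment {R : realType} {X : hilbertType R}
    (P : probability (borel_space X) R) (u : nat -> X) : orthonormal_seq u ->
  ('E_P[fun x : X => (`|x| ^+ 2)%R] < +oo)%E ->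
  (\sum_(n <oo) (sq_moment P u n)%:E < +oo)%E.
Proof.
move=> uO P2; under eq_eseriesr do rewrite -integral_inner_sqr//.
rewrite -integral_nneseries//; last 2 first.
- by move=> n; exact: measurable_inner_sqr.
- by move=> n x _; rewrite lee_fin sqr_ge0.
apply: le_lt_trans P2; rewrite expectationE; apply: le_integral_ge0 => x.
  by apply: nneseries_ge0 => n *; rewrite lee_fin sqr_ge0.
apply: lime_le.
  by apply: is_cvg_nneseries => n *; rewrite lee_fin sqr_ge0.
by apply: nearW => k; rewrite sumEFin lee_fin bessel.
Qed.

(** Either side says that <x, u_n> vanishes almost surely. *)
Lemma abs_moment_eq0 {R : realType} {X : hilbertType R}
    (P : probability (borel_space X) R) (u : nat -> X) n : orthonormal_seq u ->
  ('E_P[fun x : X => (`|x| ^+ 2)%R] < +oo)%E ->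
  abs_moment P u n = 0 <-> sq_moment P u n = 0.
Proof.
move=> uO P2; have mu : measurable_fun setT
    (fun x : borel_space X => ('[x : X, u n])%:E).
  by apply/measurable_EFinP; exact: measurable_inner.
(* [fine] sends an infinite value to 0, so finiteness is settled first, from |z| <= 1 + z^2. *)
have Efin : (\int[P]_x `|('[x : X, u n])%:E| = (abs_moment P u n)%:E)%E.
  rewrite /abs_moment expectationE fineK// ge0_fin_numE; last first.
    by apply: integral_ge0 => x _; rewrite lee_fin.
  apply: (@le_lt_trans _ _ (\int[P]_x (1 + ('[x : X, u n] ^+ 2)%:E))%E).
    apply: le_integral_ge0 => x; first by rewrite lee_fin.
    rewrite -EFinD lee_fin -real_normK ?num_real//.
    have := sqr_ge0 (`|'[x : X, u n]| - 1); have := normr_ge0 '[x : X, u n].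
    set z := `|_|; nra.
  rewrite ge0_integralD//; last 2 first.
  - by move=> x _; rewrite lee_fin sqr_ge0.
  - exact: measurable_inner_sqr.
  by rewrite integral_inner_sqr// integral_cst// mul1e [X in (X + _)%E]probability_setT ltry.
have E0 := ae_eq_integral_abs P measurableT mu.
have Q0 := ae_eq_integral_abs P measurableT (measurable_inner_sqr u n uO).
have EE : abs_moment P u n = 0 <-> (\int[P]_x `|('[x : X, u n])%:E| = 0)%E.
  by rewrite Efin; split=> [->|[]].
have QE : sq_moment P u n = 0 <-> (\int[P]_x `|('[x : X, u n] ^+ 2)%:E| = 0)%E.
  under eq_integral do rewrite gee0_abs ?lee_fin ?sqr_ge0//.
  by rewrite integral_inner_sqr//; split=> [->|[]].
rewrite EE QE E0 Q0; split; apply: filterS => x /= /(_ I) [] /eqP.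
  by move=> /eqP -> _; rewrite expr0n.
by rewrite sqrf_eq0 => /eqP -> _.
Qed.

(** * Coefficientwise bound on the squared error *)

Lemma inner_sve {R : realType} {X Y : hilbertType R}
    (A : {linear X -> Y}) (sigma : nat -> R) (u : nat -> X) (v : nat -> Y)
    (x : X) n : singular_value_expansion A sigma u v ->
  '[A x, v n] = sigma n * '[x, u n].
Proof. by move=> [_ _ [_ vO _] Av]; exact: inner_limit (Av x). Qed.

(** This is (a + b)^2 <= 2 a^2 + 2 b^2 with a = (g s - 1) c and b = g e; the gap is (a - b)^2. *)
Lemma sqr_coef_error_le {R : realFieldType} (g s c e : R) :
  (g * (s * c + e) - c) ^+ 2 <=
  2 * (1 - g * s) ^+ 2 * c ^+ 2 + 2 * g ^+ 2 * e ^+ 2.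
Proof.
rewrite -subr_ge0; have := sqr_ge0 ((g * s - 1) * c - g * e).
by congr (0 <= _); ring.
Qed.

Lemma sq_error_ge0 {R : realType} {X : hilbertType R} (s : nat -> X) (z : X) :
  (0 <= sq_error s z)%E.
Proof. by rewrite /sq_error; case: ifP => // _; rewrite lee_fin sqr_ge0. Qed.

(** The sequence [e] is arbitrary, so the bound serves both noise models. *)
Lemma sq_error_sve_le {R : realType} {X Y : hilbertType R}
    (A : {linear X -> Y}) (sigma : nat -> R) (u : nat -> X) (v : nat -> Y)
    (g e : nat -> R) (x : X) : singular_value_expansion A sigma u v ->
  (sq_error (spectral_series u g (fun n => '[A x, v n] + e n)%R)
     (pseudo_inverse A (A x)) <=
   \sum_(n <oo) (2 * (1 - g n * sigma n) ^+ 2 * '[x, u n] ^+ 2 +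
                 2 * g n ^+ 2 * e n ^+ 2)%:E)%E.
Proof.
move=> sve; have [_ [_ uO _] _ _] := sve.
apply: le_trans (sq_error_le u _ _ _ _ uO (pseudo_inverse_series _ _ _ _ x sve)) _.
apply: lee_nneseries => n *; rewrite lee_fin ?sqr_ge0//.
by rewrite (inner_sve _ _ _ _ _ _ sve) sqr_coef_error_le.
Qed.

(** * Adversarial risk *)

(** Zero noise is admissible, so the supremum is not that of the empty set, [-oo]. *)
Lemma adv_sup_ge0 {R : realType} {X Y : hilbertType R} (A : X -> Y)
    (u : nat -> X) (v : nat -> Y) (g : nat -> R) (delta : R) (x : X) :
  0 <= delta ->
  (0 <= ereal_sup
     [set sq_error (spectral_series u g (fun n => '[A x + eps, v n]))
        (pseudo_inverse A (A x)) | eps in adv_noise v delta])%E.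
Proof.
move=> d0; apply: ereal_sup_ge.
exists (sq_error (spectral_series u g (fun n => '[A x + 0, v n]))
          (pseudo_inverse A (A x))); last exact: sq_error_ge0.
by exists 0 => // n; rewrite linear0l normr0.
Qed.

Lemma adv_risk_ge0 {R : realType} {X Y : hilbertType R} (A : X -> Y)
    (u : nat -> X) (v : nat -> Y) (P : probability (borel_space X) R)
    (g : nat -> R) (delta : R) : 0 <= delta -> (0 <= adv_risk A u v P g delta)%E.
Proof. by move=> d0; apply: integral_ge0 => x _; exact: adv_sup_ge0. Qed.

(** Each noise coefficient is at most delta in absolute value, which removes the supremum before
    integration; the series left is measurable and integrated termwise. *)
Lemma adv_risk_le {R : realType} {X Y : hilbertType R} (A : {linear X -> Y})
    (sigma : nat -> R) (u : nat -> X) (v : nat -> Y)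
    (P : probability (borel_space X) R) (g : nat -> R) (delta : R) :
  0 <= delta -> singular_value_expansion A sigma u v ->
  ('E_P[fun x : X => (`|x| ^+ 2)%R] < +oo)%E ->
  (adv_risk A u v P g delta <=
   \sum_(n <oo) (2 * (1 - g n * sigma n) ^+ 2 * sq_moment P u n +
                 2 * g n ^+ 2 * delta ^+ 2)%:E)%E.
Proof.
move=> d0 sve P2; have [_ [_ uO _] _ _] := sve.
have k0 (r : R) : 0 <= 2 * r ^+ 2 by rewrite mulr_ge0// sqr_ge0.
pose f n (x : borel_space X) := (2 * (1 - g n * sigma n) ^+ 2 * '[x : X, u n] ^+ 2 +
                 2 * g n ^+ 2 * delta ^+ 2)%:E.
have f0 n x : (0 <= f n x)%E.
  by rewrite lee_fin addr_ge0// mulr_ge0 ?k0 ?sqr_ge0.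
have mf n : measurable_fun setT (f n).
  apply/measurable_EFinP; apply: measurable_funD => //.
  apply: measurable_funM => //; apply: measurable_funX.
  exact: measurable_inner.
apply: (@le_trans _ _ (\int[P]_x (\sum_(n <oo) f n x))%E).
  apply: le_integral_ge0 => x; first exact: adv_sup_ge0.
  apply: ge_ereal_sup => _ [eps epsd <-].
  rewrite (_ : (fun n => _) = (fun n => '[A x, v n] + '[eps, v n])); last first.
    by apply/funext => n; rewrite linearDl.
  apply: le_trans (sq_error_sve_le _ _ _ _ _ _ _ sve) _.
  apply: lee_nneseries => n *.
    by rewrite lee_fin addr_ge0// mulr_ge0 ?k0 ?sqr_ge0.
  rewrite lee_fin lerD2l ler_wpM2l ?k0// -(real_normK (num_real '[eps, _])).
  by rewrite ler_sqr ?nnegrE//; exact: epsd.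
rewrite integral_nneseries//; apply: lee_nneseries => n *.
  by apply: integral_ge0.
rewrite /f; under eq_integral do rewrite EFinD (EFinM (_ * _)).
rewrite ge0_integralD//=; last 3 first.
- by move=> x _; rewrite -EFinM lee_fin mulr_ge0 ?k0 ?sqr_ge0.
- by apply: measurable_funeM; exact: measurable_inner_sqr.
- by move=> x _; rewrite lee_fin mulr_ge0 ?k0 ?sqr_ge0.
rewrite ge0_integralZl_EFin//=; last 2 first.
- by move=> x _; rewrite lee_fin sqr_ge0.
- exact: measurable_inner_sqr.
by rewrite integral_inner_sqr// integral_cst// [X in (_ + _ * X)%E]probability_setT mule1.
Qed.

(** * White noise risk *)

Lemma measurable_noise_coef {R : realType} n :
  measurable_fun setT (@noise_coef R n).
Proof.
move=> _ B mB; rewrite setTI; apply: sub_sigma_algebra.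
by exists n, B.
Qed.

(** Deterministic zero noise witnesses that the supremum over noise laws is nonempty, hence
    nonnegative. *)
Lemma dirac_white_noise {R : realType} (delta : R) :
  white_noise R delta (@dirac _ (noise_space R) (fun=> 0%R) R).
Proof.
split=> n; rewrite expectationE integral_dirac//=.
- by rewrite diracT mul1e.
- apply/measurable_EFinP; exact: measurable_noise_coef.
- by rewrite diracT mul1e lee_fin /noise_coef expr0n/= sqr_ge0.
- apply/measurable_EFinP; apply: measurable_funX; exact: measurable_noise_coef.
Qed.

Lemma white_noise_risk_ge0 {R : realType} {X Y : hilbertType R} (A : X -> Y)
    (u : nat -> X) (v : nat -> Y) (P : probability (borel_space X) R)
    (g : nat -> R) (delta : R) : (0 <= white_noise_risk A u v P g delta)%E.
Proof.
apply: ereal_sup_ge.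
exists (\int[P \x (@dirac _ (noise_space R) (fun=> 0%R) R)]_w
       sq_error (spectral_series u g
                   (fun n => ('[A w.1, v n] + noise_coef n w.2)%R))
                (pseudo_inverse A (A w.1)))%E.
  exists (@dirac _ (noise_space R) (fun=> 0%R) R); last by [].
  exact: dirac_white_noise.
by apply: integral_ge0 => w _; exact: sq_error_ge0.
Qed.

(** In each summand x and the noise occur in separate terms, so after termwise integration only the
    two marginals matter. *)
Lemma white_noise_risk_le {R : realType} {X Y : hilbertType R}
    (A : {linear X -> Y})
    (sigma : nat -> R) (u : nat -> X) (v : nat -> Y)
    (P : probability (borel_space X) R) (g : nat -> R) (delta : R) :
  singular_value_expansion A sigma u v ->
  ('E_P[fun x : X => (`|x| ^+ 2)%R] < +oo)%E ->
  (white_noise_risk A u v P g delta <=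
   \sum_(n <oo) (2 * (1 - g n * sigma n) ^+ 2 * sq_moment P u n +
                 2 * g n ^+ 2 * delta ^+ 2)%:E)%E.
Proof.
move=> sve P2; have [_ [_ uO _] _ _] := sve.
apply: ge_ereal_sup => _ [Pe [_ Pe2] <-].
pose f n (w : borel_space X * noise_space R) :=
  ((2 * (1 - g n * sigma n) ^+ 2)%:E * ('[w.1 : X, u n] ^+ 2)%:E +
   (2 * g n ^+ 2)%:E * (noise_coef n w.2 ^+ 2)%:E)%E.
have k0 (r : R) : 0 <= 2 * r ^+ 2 by rewrite mulr_ge0// sqr_ge0.
have f10 n (w : borel_space X * noise_space R) :
  (0 <= (2 * (1 - g n * sigma n) ^+ 2)%:E * ('[w.1 : X, u n] ^+ 2)%:E)%E.
  by rewrite mule_ge0// lee_fin ?sqr_ge0.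
have f20 n (w : borel_space X * noise_space R) :
  (0 <= (2 * g n ^+ 2)%:E * (noise_coef n w.2 ^+ 2)%:E)%E.
  by rewrite mule_ge0// lee_fin ?sqr_ge0.
have mc n := measurable_inner_sqr u n uO.
have mc1 n : measurable_fun setT
  (fun w : borel_space X * noise_space R => ('[w.1 : X, u n] ^+ 2)%:E).
  exact: (measurableT_comp (mc n) measurable_fst).
have me n : measurable_fun setT (fun e => (@noise_coef R n e ^+ 2)%:E).
  by apply/measurable_EFinP; apply: measurable_funX; exact: measurable_noise_coef.
have me2 n : measurable_fun setT
  (fun w : borel_space X * noise_space R => (noise_coef n w.2 ^+ 2)%:E).
  exact: (measurableT_comp (me n) measurable_snd).
apply: (@le_trans _ _ (\int[P \x Pe]_w (\sum_(n <oo) f n w))%E).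
  apply: le_integral_ge0 => w; first exact: sq_error_ge0.
  apply: le_trans (sq_error_sve_le _ _ _ _ _ _ _ sve) _.
  by under eq_eseriesr do rewrite EFinD (EFinM (2 * _)) (EFinM (2 * g _ ^+ 2)).
rewrite integral_nneseries//; last 2 first.
- by move=> n; apply: emeasurable_funD; apply: measurable_funeM.
- by move=> n w _; rewrite adde_ge0.
apply: lee_nneseries => n *; first by apply: integral_ge0 => w _; rewrite adde_ge0.
rewrite ge0_integralD//=; last 2 first.
- exact: measurable_funeM.
- exact: measurable_funeM.
rewrite ge0_integralZl_EFin//=; last by move=> w _; rewrite lee_fin sqr_ge0.
rewrite ge0_integralZl_EFin//=; last by move=> w _; rewrite lee_fin sqr_ge0.
rewrite (integral_fst P Pe (mc n)); last by move=> x; rewrite lee_fin sqr_ge0.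
rewrite (integral_snd P Pe (me n)); last by move=> x; rewrite lee_fin sqr_ge0.
rewrite integral_inner_sqr// EFinD leeD2l// (EFinM (2 * g n ^+ 2)).
by rewrite lee_wpmul2l ?lee_fin ?k0// -expectationE.
Qed.

(** * The limit as delta tends to 0 *)

Theorem theorem14 (R : realType) (X Y : hilbertType R) (A : {linear X -> Y})
    (A_compact : compact_operator A)
    (sigma : nat -> R) (u : nat -> X) (v : nat -> Y)
    (A_sve : singular_value_expansion A sigma u v)
    (Px : probability (borel_space X) R)
    (Px_sq : ('E_Px[fun x : X => (`|x| ^+ 2)%R] < +oo)%E)
    (Pt : probability (borel_space X) R)
    (Pt_sq : ('E_Pt[fun x : X => (`|x| ^+ 2)%R] < +oo)%E)
    (* no test mass along directions never seen in training: without this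
       the limit fails, as g_adv vanishes on those directions *)
    (Px_Pt : forall n, abs_moment Px u n = 0 -> abs_moment Pt u n = 0) :
  adv_risk A u v Pt (g_adv Px sigma u delta) delta @[delta --> 0^'+] --> 0%E
  /\
  white_noise_risk A u v Pt (g_adv Px sigma u delta) delta
    @[delta --> 0^'+] --> 0%E.
Proof.
have [s0 [_ uO _] _ _] := A_sve.
(* The n-th term of the bound common to both risks. *)
pose a delta n := 2 * (1 - g_adv Px sigma u delta n * sigma n) ^+ 2 *
  sq_moment Pt u n + 2 * g_adv Px sigma u delta n ^+ 2 * delta ^+ 2.
suff a0 : (\sum_(n <oo) (a delta n)%:E)%E @[delta --> 0^'+] --> 0%E.
  split; apply: (@squeeze_cvge _ _ _ _ (fun=> 0%E) _ _ _ _ _ a0);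
    (try exact: cvg_cst); near=> delta.
  - have d0 : 0 <= delta by near: delta; exact: nbhs_right_ge.
    by rewrite adv_risk_ge0//= adv_risk_le.
  - by rewrite white_noise_risk_ge0/= white_noise_risk_le.
(* Dominating sequence: [g_adv_bounds] gives (1 - g sigma_n)^2 <= 1 and delta^2 g^2 <= Q_n. *)
pose b n := 2 * sq_moment Pt u n + 2 * sq_moment Px u n.
have g_bounds delta n : 0 < delta -> _ := fun d0 => g_adv_bounds Px sigma u
  delta n d0 (s0 n) (abs_moment_ge0 Px u n) (sq_moment_ge0 Px u n).
apply: (nneseries_dominated_cvg0 _ _ _ _ _ b).
- by move=> n; rewrite addr_ge0// mulr_ge0// sq_moment_ge0.
- under eq_eseriesr do rewrite EFinD !EFinM.
  rewrite nneseriesD; last 2 first.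
  + by move=> n *; rewrite mule_ge0// lee_fin sq_moment_ge0.
  + by move=> n *; rewrite mule_ge0// lee_fin sq_moment_ge0.
  rewrite !nneseriesZl; last 2 first.
  + by move=> n *; rewrite lee_fin sq_moment_ge0.
  + by move=> n *; rewrite lee_fin sq_moment_ge0.
  by rewrite lte_add_pinfty// lte_mul_pinfty// nneseries_sq_moment.
- near=> delta => n; have d0 : 0 < delta by [].
  have [g0 gs gd] := g_bounds delta n d0.
  have k0 r : 0 <= 2 * r ^+ 2 :> R by rewrite mulr_ge0// sqr_ge0.
  rewrite addr_ge0/= ?(mulr_ge0 (k0 _))// ?sqr_ge0 ?sq_moment_ge0//.
  apply: lerD; rewrite -mulrA ler_pM2l//; last by rewrite mulrC.
  have gs0 : 0 <= 1 - g_adv Px sigma u delta n * sigma n by rewrite subr_ge0.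
  rewrite ler_piMl ?sq_moment_ge0// exprn_ile1// lerBlDr lerDl mulr_ge0//.
  exact: ltW.
- move=> n; have [E0|En0] := eqVneq (abs_moment Px u n) 0.
    (* Here g_n = 0 leaves the full bias, which vanishes because the test law has no mass in this
       direction either. *)
    have Qt0 : sq_moment Pt u n = 0.
      by apply/(abs_moment_eq0 Pt u n uO Pt_sq)/Px_Pt.
    apply: cvg_near_cst; near=> delta.
    by rewrite /a Qt0 mulr0 add0r /g_adv E0 eqxx/= expr0n/= mulr0 mul0r.
  have E0 : 0 < abs_moment Px u n by rewrite lt_neqAle eq_sym En0 abs_moment_ge0.
  have Q0 : 0 < sq_moment Px u n.
    rewrite lt_neqAle sq_moment_ge0 andbT eq_sym; apply: contra_neq En0.
    by move=> /(abs_moment_eq0 Px u n uO Px_sq).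
  (* For small delta the bias is zero and only a multiple of delta^2 remains. *)
  have ga : {near 0^'+, (fun delta => 2 * (sigma n)^-1 ^+ 2 * delta ^+ 2) =1 a^~ n}.
    apply: filterS (g_adv_near0 Px sigma u n (s0 n) E0 Q0) => delta gE.
    by rewrite /a gE mulVf ?gt_eqF// subrr expr0n/= mulr0 mul0r add0r.
  apply: cvg_trans (near_eq_cvg ga) _; apply: cvg_at_right_filter.
  rewrite -[X in _ --> X](mulr0 (2 * (sigma n)^-1 ^+ 2)).
  apply: cvgM; first exact: cvg_cst.
  rewrite -[X in _ --> X](expr0n R 2); exact: exprn_continuous.
Unshelve. all: by end_near. Qed.
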